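(* Let $\Bbbk$ be any field and let $\mathcal{L}\subset\mathbb{P}^2_{\Bbbk}$ be an arrangement of $k\geq 3$ lines with $s$ intersection points. Let $I(G)\subset\Bbbk[x_1,\dots,x_s,y_1,\dots,y_k]$ be the edge ideal of the Levi graph $G$ associated with $\mathcal{L}$. Then $\Bbbk[x_1,\dots,x_s,y_1,\dots,y_k]/I(G)$ is not Cohen-Macaulay.
   Context: $\mathcal{L}=\{\ell_1,\dots,\ell_k\}$ consists of $k$ distinct lines. The intersection points $p_1,\dots,p_s$ are the points of the plane lying on at least two lines of $\mathcal{L}$. The Levi graph $G$ of $\mathcal{L}$ is the bipartite graph with vertex set $\{x_1,\dots,x_s\}\cup\{y_1,\dots,y_k\}$ in which $x_j$ and $y_i$ are joined by an edge if and only if $p_j\in\ell_i$. Its edge ideal $I(G)$ is the ideal generated by all $x_jy_i$ such that $x_j$ and $y_i$ are adjacent. *)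

(* Defs.v *)
From HB Require Import structures.
From mathcomp Require Import all_boot all_algebra.
From mathcomp Require Import generic_quotient ring_quotient.
From mathcomp Require Import boolp.
From mathcomp Require Import mpoly.
From mathcomp Require Import ring.

Set Implicit Arguments.
Unset Strict Implicit.
Unset Printing Implicit Defensive.

Import GRing.Theory.
Local Open Scope ring_scope.
Local Open Scope quotient_scope.

(* The library structures [idealr R] and [prime_idealr R] are the proper ideals
   and the (proper) prime ideals of R, as boolean predicates; by classical
   logic every ideal has this form. *)

Section Ideals.
Variable R : comNzRingType.

Definition gen_ideal (g : seq R) : {pred R} :=
  fun x => `[< exists c : 'I_(size g) -> R, x = \sum_(i < size g) c i * g`_i >].

(* It suffices to quantify over the proper ideals: the unit ideal is (1). *)
Definition noetherian := forall I : idealr R, exists g : seq R, I =i gen_ideal g.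

Definition maximal_ideal (m : idealr R) :=
  forall I : idealr R, {subset m <= I} -> {subset I <= m}.

Definition local_ring (m : idealr R) :=
  maximal_ideal m /\ forall m' : idealr R, maximal_ideal m' -> m' =i m.

Definition prime_chain (n : nat) :=
  exists P : 'I_n.+1 -> prime_idealr R,
    forall i j : 'I_n.+1, (i < j)%N ->
      {subset P i <= P j} /\ ~ {subset P j <= P i}.

Definition krull_dim (d : nat) :=
  prime_chain d /\ forall n, prime_chain n -> (n <= d)%N.

(* The i-th element is a nonzerodivisor modulo the ideal of the previous ones,
   and the whole sequence does not generate the unit ideal. *)
Definition regular_seq (x : seq R) :=
  (forall i, (i < size x)%N ->
     forall b, x`_i * b \in gen_ideal (take i x) -> b \in gen_ideal (take i x))
  /\ 1 \notin gen_ideal x.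

Definition depth (m : idealr R) (d : nat) :=
  (exists x : seq R, [/\ {subset x <= m}, regular_seq x & size x = d]) /\
  forall x : seq R, {subset x <= m} -> regular_seq x -> (size x <= d)%N.

Definition cohen_macaulay_local :=
  noetherian /\
  exists m : idealr R,
    local_ring m /\ exists d : nat, depth m d /\ krull_dim d.

End Ideals.

Module Localization.
Section Localization.
Variables (R : comNzRingType) (P : prime_idealr R).

Definition denom := {s : R | s \notin (P : {pred R})}.
Definition frac := (R * denom)%type.

Lemma one_denom : 1 \notin (P : {pred R}).
Proof. by rewrite idealr1. Qed.

Lemma mul_denom (s t : denom) : val s * val t \notin (P : {pred R}).
Proof. by rewrite prime_idealrM negb_or (valP s) (valP t). Qed.

Definition denom1 : denom := Sub 1 one_denom.
Definition denomM (s t : denom) : denom := Sub (val s * val t) (mul_denom s t).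

Definition equivl (x y : frac) : bool :=
  `[< exists u : denom, val u * (x.1 * val y.2 - y.1 * val x.2) = 0 >].

Lemma equivl_refl : reflexive equivl.
Proof. by move=> x; apply/asboolP; exists denom1; rewrite subrr mulr0. Qed.

Lemma equivl_sym : ssrbool.symmetric equivl.
Proof.
suff h x y : equivl x y -> equivl y x by move=> x y; apply/idP/idP; apply: h.
move=> /asboolP[u hu]; apply/asboolP; exists u.
by rewrite -opprB mulrN hu oppr0.
Qed.

Lemma equivl_trans : transitive equivl.
Proof.
move=> y x z /asboolP[u hu] /asboolP[v hv]; apply/asboolP.
exists (denomM (denomM u v) y.2) => /=.
transitivity ((val v * val z.2) * (val u * (x.1 * val y.2 - y.1 * val x.2))
  + (val u * val x.2) * (val v * (y.1 * val z.2 - z.1 * val y.2))).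
  by rewrite /=; ring.
by rewrite hu hv !mulr0 addr0.
Qed.

Canonical equivl_equiv :=
  EquivRel equivl equivl_refl equivl_sym equivl_trans.

Definition type := {eq_quot equivl}.

#[export]
HB.instance Definition _ : EqQuotient _ equivl type := EqQuotient.on type.
#[export]
HB.instance Definition _ := Choice.on type.

Lemma eq_fracP (x y : frac) :
  reflect (exists u : denom, val u * (x.1 * val y.2 - y.1 * val x.2) = 0)
          (x == y %[mod type]).
Proof. by rewrite eqmodE; apply: asboolP. Qed.

Lemma repr_frac (x : frac) : exists u : denom,
  val u * (x.1 * val (repr (\pi_type x)).2
           - (repr (\pi_type x)).1 * val x.2) = 0.
Proof. by apply/eq_fracP; rewrite reprK. Qed.

Definition addf (x y : frac) : frac :=
  (x.1 * val y.2 + y.1 * val x.2, denomM x.2 y.2).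
Definition oppf (x : frac) : frac := (- x.1, x.2).
Definition mulf (x y : frac) : frac := (x.1 * y.1, denomM x.2 y.2).

Definition zero : type := lift_cst type (0, denom1).
Definition one : type := lift_cst type (1, denom1).
Definition add := lift_op2 type addf.
Definition opp := lift_op1 type oppf.
Definition mul := lift_op2 type mulf.

Canonical pi_zero_morph := PiConst zero.
Canonical pi_one_morph := PiConst one.

Lemma pi_add : {morph \pi : x y / addf x y >-> add x y}.
Proof.
move=> x y; unlock add; apply/eqP/eq_fracP.
have [u hu] := repr_frac x; have [v hv] := repr_frac y.
exists (denomM u v) => /=; move: (repr (\pi_type x)) (repr (\pi_type y)) hu hv => x' y' hu hv.
transitivity ((val v * val y.2 * val y'.2)
    * (val u * (x.1 * val x'.2 - x'.1 * val x.2))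
  + (val u * val x.2 * val x'.2)
    * (val v * (y.1 * val y'.2 - y'.1 * val y.2))); first by rewrite /=; ring.
by rewrite hu hv !mulr0 addr0.
Qed.
Canonical pi_add_morph := PiMorph2 pi_add.

Lemma pi_opp : {morph \pi : x / oppf x >-> opp x}.
Proof.
move=> x; unlock opp; apply/eqP/eq_fracP.
have [u hu] := repr_frac x; exists u => /=; move: (repr _) hu => x' hu.
transitivity (- (val u * (x.1 * val x'.2 - x'.1 * val x.2))).
  by rewrite /=; ring.
by rewrite hu oppr0.
Qed.
Canonical pi_opp_morph := PiMorph1 pi_opp.

Lemma pi_mul : {morph \pi : x y / mulf x y >-> mul x y}.
Proof.
move=> x y; unlock mul; apply/eqP/eq_fracP.
have [u hu] := repr_frac x; have [v hv] := repr_frac y.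
exists (denomM u v) => /=; move: (repr (\pi_type x)) (repr (\pi_type y)) hu hv => x' y' hu hv.
transitivity ((val v * y.1 * val y'.2)
    * (val u * (x.1 * val x'.2 - x'.1 * val x.2))
  + (val u * val x.2 * x'.1)
    * (val v * (y.1 * val y'.2 - y'.1 * val y.2))); first by rewrite /=; ring.
by rewrite hu hv !mulr0 addr0.
Qed.
Canonical pi_mul_morph := PiMorph2 pi_mul.

Lemma eq_frac (x y : frac) :
  x.1 * val y.2 = y.1 * val x.2 -> x = y %[mod type].
Proof. by move=> h; apply/eqP/eq_fracP; exists denom1; rewrite h subrr mulr0. Qed.

Lemma addA : associative add.
Proof.
elim/quotW=> x; elim/quotW=> y; elim/quotW=> z; rewrite !piE.
by apply: eq_frac => /=; ring.
Qed.

Lemma addC : commutative add.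
Proof.
elim/quotW=> x; elim/quotW=> y; rewrite !piE.
by apply: eq_frac => /=; ring.
Qed.

Lemma add0 : left_id zero add.
Proof. by elim/quotW=> x; rewrite !piE; apply: eq_frac => /=; ring. Qed.

Lemma addN : left_inverse zero opp add.
Proof. by elim/quotW=> x; rewrite !piE; apply: eq_frac => /=; ring. Qed.

#[export]
HB.instance Definition _ := GRing.isZmodule.Build type addA addC add0 addN.

Lemma mulA : associative mul.
Proof.
elim/quotW=> x; elim/quotW=> y; elim/quotW=> z; rewrite !piE.
by apply: eq_frac => /=; ring.
Qed.

Lemma mulC : commutative mul.
Proof.
elim/quotW=> x; elim/quotW=> y; rewrite !piE.
by apply: eq_frac => /=; ring.
Qed.

Lemma mul1 : left_id one mul.
Proof. by elim/quotW=> x; rewrite !piE; apply: eq_frac => /=; ring. Qed.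

Lemma mulDl : left_distributive mul add.
Proof.
elim/quotW=> x; elim/quotW=> y; elim/quotW=> z; rewrite !piE.
by apply: eq_frac => /=; ring.
Qed.

Lemma nonzero1 : one != zero.
Proof.
rewrite !piE; apply/negP => /asboolP[u] /=.
rewrite mulr1 mul0r subr0 mulr1 => hu.
by have := valP u; rewrite [\val u]hu idealr0.
Qed.

#[export]
HB.instance Definition _ :=
  GRing.Zmodule_isComNzRing.Build type mulA mulC mul1 mulDl nonzero1.

End Localization.

Module Exports. HB.reexport. End Exports.
End Localization.

Export Localization.Exports.

Notation localization := Localization.type.

(* Maximal ideals are prime, so P ranges over all maximal ideals of R; the
   prime structure is what [localization] requires. *)
Definition cohen_macaulay (R : comNzRingType) :=
  noetherian R /\
  forall P : prime_idealr R,
    maximal_ideal P -> cohen_macaulay_local (localization P).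

Section EdgeIdeal.
Variables (K : fieldType) (n : nat) (adj : rel 'I_n).

Definition edge_gens : seq {mpoly K[n]} :=
  [seq 'X_e.1 * 'X_e.2 | e <- enum {: 'I_n * 'I_n} & adj e.1 e.2].

Definition edge_ideal : {pred {mpoly K[n]}} := gen_ideal edge_gens.

Lemma edge_ideal_closed : idealr_closed edge_ideal.
Proof.
split.
- apply/asboolP; exists (fun=> 0); rewrite big1 // => i _; exact: mul0r.
- apply/asboolP => -[c /(congr1 (meval (fun=> 0)))].
  rewrite rmorph1 raddf_sum big1 => [/eqP|i _]; first by rewrite oner_eq0.
  rewrite [LHS]mevalM.
  have /mapP[e _ ->] : edge_gens`_i \in edge_gens by apply: mem_nth.
  by rewrite mevalM !mevalXU mul0r mulr0.
- move=> a x y /asboolP[c ->] /asboolP[d ->]; apply/asboolP.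
  exists (fun i => a * c i + d i); rewrite mulr_sumr -big_split /=.
  by apply: eq_bigr => i _; rewrite mulrDl mulrA.
Qed.

HB.instance Definition _ := isIdealr.Build _ edge_ideal edge_ideal_closed.

End EdgeIdeal.

Arguments edge_gens K {n} adj.
Arguments edge_ideal K {n} adj.

(* Points and lines of the projective plane over K are the subspaces of K^3 of
   dimension 1 and 2, and incidence is inclusion. *)
Section LineArrangement.
Variable K : fieldType.

Definition line_arrangement (k : nat) (l : 'I_k -> {vspace 'rV[K]_3}) :=
  injective l /\ forall i, \dim (l i) = 2%N.

Definition intersection_points (k s : nat)
    (l : 'I_k -> {vspace 'rV[K]_3}) (p : 'I_s -> {vspace 'rV[K]_3}) :=
  injective p /\
  forall q : {vspace 'rV[K]_3},
    (exists j, p j = q) <->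
    \dim q = 1%N /\
    exists i1 i2, [/\ i1 != i2, (q <= l i1)%VS & (q <= l i2)%VS].

(* The vertex x_j is [lshift k j] and the vertex y_i is [rshift s i]. *)
Definition levi_graph (k s : nat)
    (l : 'I_k -> {vspace 'rV[K]_3}) (p : 'I_s -> {vspace 'rV[K]_3}) :
    rel 'I_(s + k) :=
  fun u v => match split u, split v with
             | inl j, inr i | inr i, inl j => (p j <= l i)%VS
             | _, _ => false
             end.

End LineArrangement.

(* Main.v *)
Require Import Defs.
From HB Require Import structures.
From mathcomp Require Import all_boot all_algebra.
From mathcomp Require Import generic_quotient ring_quotient.
From mathcomp Require Import boolp.
From mathcomp Require Import mpoly.
From mathcomp Require Import ring.

Set Implicit Arguments.
Unset Strict Implicit.
Unset Printing Implicit Defensive.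

Import GRing.Theory.
Local Open Scope ring_scope.
Local Open Scope quotient_scope.

(** Let [A = K[X] / I(G)] for a graph [G] and let [S] be the localization of [A]
    at the origin.  If [S] is Cohen-Macaulay, then no independent set of [G] is
    larger than a maximal one ([cohen_macaulay_unmixed]), for two reasons.

    - The dimension of [S] is at least [#|V|] for every independent set [V]:
      killing the variables outside smaller and smaller subsets of [V] gives a
      strictly increasing chain of primes ([independent_le_krull_dim]).
    - The depth of [S] is at most [#|F|] for every maximal independent set [F]
      ([depth_le_maximal_independent]).  The product [u] of the variables in [F]
      is nonzero in [S] but annihilated by the variables outside [F].  More than
      [#|F|] elements of [S] are fractions that, modulo the variables outside
      [F], satisfy a nontrivial polynomial relation over [K], found by counting
      coefficients ([algebraic_dependence]); multiplied by [u], this relation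
      holds in [S].  But a regular sequence in the maximal ideal admits no such
      relation ([regular_seq_no_relation]): one cancels a least monomial in the
      lexicographic order, using that in a Noetherian local ring [u] has an exact order of
      divisibility by each term of the sequence ([exact_divisor]).

    The Levi graph of an arrangement is not unmixed in this sense.  If every
    line has at least two points, the set of all points is independent, and
    replacing the points of one line by that line gives a smaller maximal
    independent set ([line_maximal_independent]).  Otherwise some line has a
    single point, all lines pass through it, and this point is a maximal
    independent set ([pencil_maximal_independent]) smaller than the set of the
    [k >= 3] lines. *)

(** * Regular sequences and polynomial relations *)

Section GeneratedIdeals.
Variable R : comNzRingType.
Implicit Types (g x : seq R) (u v w y t : R).

Lemma gen_idealP g w : reflect
  (exists c : nat -> R, w = \sum_(i < size g) c i * g`_i) (w \in gen_ideal g).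
Proof.
apply: (iffP (asboolP _)) => -[c ->]; last by exists (fun i => c i).
exists (fun i => if insub i is Some j then c j else 0).
by apply: eq_bigr => i _; rewrite valK.
Qed.

Lemma gen_ideal_zmod_closed g : zmod_closed (gen_ideal g).
Proof.
split=> [|_ _ /gen_idealP[c ->] /gen_idealP[d ->]]; apply/gen_idealP.
  by exists (fun=> 0); rewrite big1 // => i _; rewrite mul0r.
exists (fun i => c i - d i); rewrite -sumrB.
by apply: eq_bigr => i _; rewrite mulrBl.
Qed.

HB.instance Definition _ g :=
  GRing.isZmodClosed.Build R (gen_ideal g) (gen_ideal_zmod_closed g).

Lemma gen_idealMl g t w : w \in gen_ideal g -> t * w \in gen_ideal g.
Proof.
move=> /gen_idealP[c ->]; apply/gen_idealP; exists (fun i => t * c i).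
by rewrite mulr_sumr; apply: eq_bigr => i _; rewrite mulrA.
Qed.

Lemma gen_ideal_nil w : (w \in gen_ideal [::]) = (w == 0).
Proof.
apply/idP/eqP => [/gen_idealP[c ->]|->]; first by rewrite big_ord0.
exact: rpred0.
Qed.

Lemma gen_ideal_rcons g y w :
  w \in gen_ideal (rcons g y) <-> exists t, w - t * y \in gen_ideal g.
Proof.
split=> [/gen_idealP[c]|[t /gen_idealP[c]]].
  rewrite size_rcons big_ord_recr /= nth_rcons ltnn eqxx => ->.
  exists (c (size g)); rewrite addrK; apply/gen_idealP; exists c.
  by apply: eq_bigr => i _; rewrite nth_rcons ltn_ord.
move/(canRL (subrK _)) => ->; apply/gen_idealP.
exists (fun i => if (i < size g)%N then c i else t).
rewrite size_rcons big_ord_recr /= nth_rcons ltnn eqxx; congr (_ + _).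
by apply: eq_bigr => i _; rewrite nth_rcons ltn_ord.
Qed.

Lemma mem_gen_ideal g y : y \in g -> y \in gen_ideal g.
Proof.
elim/last_ind: g => // g z IH; rewrite mem_rcons inE => /predU1P[->|/IH yg].
  by apply/gen_ideal_rcons; exists 1; rewrite mul1r subrr rpred0.
by apply/gen_ideal_rcons; exists 0; rewrite mul0r subr0.
Qed.

(** The colon ideals [(g : y^a)] increase with [a] and their union is an
    ideal; a finite set of generators of the union bounds the exponent. *)
Lemma noetherian_saturation g y : noetherian R ->
  exists a, forall b w,
    y ^+ b * w \in gen_ideal g -> y ^+ a * w \in gen_ideal g.
Proof.
move=> noeth.
have up a b w : (a <= b)%N -> y ^+ a * w \in gen_ideal g ->
    y ^+ b * w \in gen_ideal g.
  by move=> /subnK <- yw; rewrite exprD -mulrA gen_idealMl.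
pose S : {pred R} := fun w => `[< exists b, y ^+ b * w \in gen_ideal g >].
have [/asboolP[a]|S1] := boolP (1 \in S).
  by rewrite mulr1 => ya; exists a => b w _; rewrite mulrC gen_idealMl.
have S_closed : idealr_closed S.
  split=> [||t v w /asboolP[b vb] /asboolP[d wd]]; [|exact: S1|]; apply/asboolP.
    by exists 0%N; rewrite mulr0 rpred0.
  exists (maxn b d); rewrite mulrDr mulrCA; apply: rpredD.
    by rewrite gen_idealMl // (up _ _ _ (leq_maxl b d) vb).
  exact: up (leq_maxr b d) wd.
pose I : idealr R := HB.pack S (isIdealr.Build R S S_closed).
have [h Sh] := noeth I.
have [a ha] : exists a, forall w, w \in h -> y ^+ a * w \in gen_ideal g.
  have : {subset h <= S} by move=> w /mem_gen_ideal; rewrite -Sh.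
  elim: {Sh} h => [|w h IH] hS; first by exists 0%N.
  have [a ha] : exists a, forall w, w \in h -> y ^+ a * w \in gen_ideal g.
    by apply: IH => v vh; apply: hS; rewrite inE vh orbT.
  have /asboolP[b wb] : w \in S by apply: hS; rewrite mem_head.
  exists (maxn a b) => v; rewrite inE => /predU1P[->|/ha].
    exact: up (leq_maxr a b) wb.
  exact: up (leq_maxl a b).
exists a => b w ybw.
have : w \in gen_ideal h by rewrite -Sh; apply/asboolP; exists b.
move=> /gen_idealP[c ->]; rewrite mulr_sumr rpred_sum // => i _.
by rewrite mulrCA gen_idealMl // ha // mem_nth.
Qed.

(** Membership in the Jacobson radical.  The inverse is spelled out because [R]
    carries no unit structure. *)
Definition in_jacobson_radical y := forall t, exists v, v * (1 - t * y) = 1.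

Lemma regular_expr g y a w :
    (forall b, y * b \in gen_ideal g -> b \in gen_ideal g) ->
  y ^+ a * w \in gen_ideal g -> w \in gen_ideal g.
Proof.
by move=> reg; elim: a => [|a IH]; rewrite ?mul1r // exprS -mulrA => /reg.
Qed.

(** Krull's intersection theorem for one element [y]: modulo [g], a nonzero [u]
    is divisible by a largest power of [y].  Otherwise, with [a] the exponent
    of saturation of [(g, u)] and [u = y^(a+1) w], the element [y^a w] would be
    a multiple of [u], hence of [y^(a+1) w]. *)
Lemma exact_divisor g y u : noetherian R -> in_jacobson_radical y ->
    (forall b, y * b \in gen_ideal g -> b \in gen_ideal g) ->
    u \notin gen_ideal g ->
  exists b w, u - y ^+ b * w \in gen_ideal g /\ w \notin gen_ideal (rcons g y).
Proof.
move=> noeth rad_y reg uNg; apply: contrapT => no_exact.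
have div b : exists w, u - y ^+ b * w \in gen_ideal g.
  elim: b => [|b [w uw]]; first by exists u; rewrite mul1r subrr rpred0.
  have /gen_ideal_rcons[t wt] : w \in gen_ideal (rcons g y).
    by apply: contrapT => /negP wNg; apply: no_exact; exists b, w.
  exists t; rewrite (_ : _ - _ = u - y ^+ b * w + y ^+ b * (w - t * y)).
    by rewrite rpredD // gen_idealMl.
  by rewrite exprS; ring.
have [a sat] := noetherian_saturation (rcons g u) y noeth.
have [w uw] := div a.+1.
have /sat/gen_ideal_rcons[t yat] : y ^+ a.+1 * w \in gen_ideal (rcons g u).
  apply/gen_ideal_rcons; exists 1.
  by rewrite mul1r -opprB rpredN.
have [v hv] := rad_y t.
have wg : w \in gen_ideal g.
  apply: (regular_expr (a := a) reg).
  rewrite -[_ * w]mul1r -hv -mulrA gen_idealMl //.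
  rewrite (_ : _ * _ = (y ^+ a * w - t * u) + t * (u - y ^+ a.+1 * w)).
    by rewrite rpredD // gen_idealMl.
  by rewrite exprS; ring.
by case/negP: uNg; rewrite -(subrK (y ^+ a.+1 * w) u) rpredD // gen_idealMl.
Qed.

(** Modulo the first [j] elements of the sequence, cancel from the relation the
    least power of the next element [y] and from [u] the exact power of [y]
    dividing it; modulo [y], the terms with least exponent survive, and so does
    the quotient of [u].  At the end a single monomial of the relation is left,
    and its unit coefficient annihilates a nonzero element. *)
Lemma regular_seq_no_relation x D (T : {set {ffun 'I_(size x) -> 'I_D}})
    (c : {ffun 'I_(size x) -> 'I_D} -> R) u :
    noetherian R -> regular_seq x -> {in x, forall y, in_jacobson_radical y} ->
    T != set0 -> {in T, forall e, exists v, v * c e = 1} -> u != 0 ->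
  (\sum_(e in T) c e * \prod_(i < size x) x`_i ^+ e i) * u != 0.
Proof.
move=> noeth [reg _] rad T0 c_unit u0; apply/negP => /eqP rel.
have partial j : (j <= size x)%N ->
  exists (T' : {set {ffun 'I_(size x) -> 'I_D}}) (u' : R),
    [/\ T' \subset T, T' != set0, u' \notin gen_ideal (take j x),
     {in T' &, forall e f : {ffun _}, forall i : 'I_(size x),
       (i < j)%N -> e i = f i} &
     (\sum_(e in T') c e * \prod_(i < size x | (j <= i)%N) x`_i ^+ e i) * u'
       \in gen_ideal (take j x)].
  elim: j => [_|j IH jx].
    exists T, u; split=> //; first by rewrite take0 gen_ideal_nil.
    by rewrite take0 gen_ideal_nil rel.
  have {IH} [T1 [w [sT1 T1n0 wN eqT1 rel1]]] := IH (ltnW jx).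
  set y := x`_j; set J := take j x in wN rel1.
  have regJ : forall b, y * b \in gen_ideal J -> b \in gen_ideal J.
    exact: reg.
  pose j' := Ordinal jx.
  have [e0 e0T] := set0Pn _ T1n0.
  case: (arg_minnP (fun e : {ffun 'I_(size x) -> 'I_D} => e j' : nat) e0T) =>
    e1 e1T min_e1; set a := (e1 j' : nat) in min_e1.
  have [b [w' [ww' w'N]]] := exact_divisor noeth (rad _ (mem_nth 0 jx)) regJ wN.
  pose T2 := [set e in T1 | e j' == e1 j'].
  pose m (e : {ffun 'I_(size x) -> 'I_D}) :=
    \prod_(i < size x | (j < i)%N) x`_i ^+ e i.
  have rel2 :
      (\sum_(e in T1) c e * (y ^+ (e j' - a) * m e)) * w' \in gen_ideal J.
    apply: (regular_expr (a := b) regJ); apply: (regular_expr (a := a) regJ).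
    set W := \sum_(e in T1) _.
    have WE : y ^+ a * W =
        \sum_(e in T1) c e * \prod_(i < size x | (j <= i)%N) x`_i ^+ e i.
      rewrite mulr_sumr; apply: eq_bigr => e eT.
      rewrite mulrCA [y ^+ a * _]mulrA -exprD subnKC ?min_e1 //.
      rewrite [in RHS](bigD1 j') //=; congr (_ * (_ * _)).
      by apply: eq_bigl => i; rewrite ltn_neqAle eq_sym andbC.
    rewrite -WE in rel1.
    rewrite (_ : _ * _ = y ^+ a * W * w - y ^+ a * W * (w - y ^+ b * w')).
      by rewrite rpredB // gen_idealMl.
    by ring.
  exists T2, w'; split.
  - by apply: subset_trans sT1; apply/subsetP => e; rewrite inE => /andP[].
  - by apply/set0Pn; exists e1; rewrite inE eqxx andbT.
  - by rewrite (take_nth 0).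
  - move=> e f; rewrite !inE => /andP[eT /eqP ej] /andP[fT /eqP fj] i.
    rewrite ltnS leq_eqVlt => /predU1P[ij|]; last exact: eqT1.
    by rewrite (_ : i = j') ?ej ?fj //; apply: val_inj.
  - rewrite (take_nth 0) //; apply/gen_ideal_rcons.
    set W := \sum_(e in T2) _.
    pose Z := \sum_(e in T1 | e j' != e1 j') c e * (y ^+ (e j' - a).-1 * m e).
    exists (- (Z * w')).
    have -> : W * w' - - (Z * w') * y = (W + y * Z) * w' by ring.
    suff <- : \sum_(e in T1) c e * (y ^+ (e j' - a) * m e) = W + y * Z by [].
    rewrite (bigID (fun e : {ffun _} => e j' == e1 j')) /=; congr (_ + _).
      rewrite /W; apply: eq_big => [e|e /andP[_ /eqP eE]]; first by rewrite inE.
      by rewrite /a eE subnn mul1r.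
    rewrite mulr_sumr; apply: eq_bigr => e /andP[eT ne].
    have a_lt : (a < e j')%N by rewrite ltn_neqAle min_e1 // andbT eq_sym.
    by rewrite [in RHS]mulrCA [y * (y ^+ _ * _)]mulrA -exprS prednK // subn_gt0.
have [T' [u' [sT T'0 u'N eqT']]] := partial _ (leqnn _).
have [e eT'] := set0Pn _ T'0.
have -> : T' = [set e].
  apply/setP => f; rewrite inE; apply/idP/eqP => [fT'|-> //].
  by apply/ffunP => i; apply: eqT'.
have [v vc] := c_unit e (subsetP sT _ eT').
rewrite big_set1 big1 ?mulr1 => [|i]; last by rewrite leqNgt ltn_ord.
move=> /(gen_idealMl v); rewrite mulrA vc mul1r => u'J.
by rewrite u'J in u'N.
Qed.

End GeneratedIdeals.

(** * Algebraic dependence of fractions *)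

Section Counting.
Variables (K : fieldType) (n : nat).
Implicit Types (f g : {mpoly K[n]}).

Lemma msizeM_leS f g a b :
  (msize f <= a.+1)%N -> (msize g <= b.+1)%N -> (msize (f * g) <= (a + b).+1)%N.
Proof.
have [->|f0] := eqVneq f 0; first by rewrite mul0r msize0.
have [->|g0] := eqVneq g 0; first by rewrite mulr0 msize0.
move=> fa gb; rewrite msizeM // -ltnS prednK; last first.
  by rewrite addn_gt0 lt0n msize_poly_eq0 f0.
by apply: leq_trans (leq_add fa gb) _; rewrite addSn addnS.
Qed.

Lemma msizeX_leS f d e :
  (msize f <= d.+1)%N -> (msize (f ^+ e) <= (e * d).+1)%N.
Proof.
move=> fd; elim: e => [|e IH]; first by rewrite expr0 msize1.
by rewrite exprS mulSn msizeM_leS.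
Qed.

Lemma msize_prod_leS r (F : 'I_r -> {mpoly K[n]}) d :
  (forall i, msize (F i) <= d.+1)%N -> (msize (\prod_i F i) <= (r * d).+1)%N.
Proof.
move=> Fd; elim: r F Fd => [|r IH] F Fd; first by rewrite big_ord0 msize1.
by rewrite big_ord_recl mulSn msizeM_leS // IH.
Qed.

(** This is the algebraic dependence of more than [#|V|] fractions [f i / g i]
    in the variables of [V], with denominators cleared.  There are [(D + 1) ^ r]
    monomials in the fractions with exponents at most [D]; over the common
    denominator [\prod_i g i ^+ D] their numerators have degree [O(D)], so they
    only have [O(D ^ #|V|)] coefficients on the variables of [V]. *)
Lemma algebraic_dependence r (f g : 'I_r -> {mpoly K[n]}) (V : {set 'I_n}) :
    (#|V| < r)%N ->
  exists D (c : {ffun 'I_r -> 'I_D.+1} -> K),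
    (exists e, c e != 0) /\
    forall m : 'X_{1..n}, (forall v, v \notin V -> m v = 0%N) ->
      (\sum_e c e *: \prod_i (f i ^+ e i * g i ^+ (D - e i)))@_m = 0.
Proof.
move=> ltVr.
pose d := \max_i maxn (msize (f i)) (msize (g i)).
have fd i : (msize (f i) <= d)%N.
  exact: leq_trans (leq_maxl _ _) (leq_bigmax i).
have gd i : (msize (g i) <= d)%N.
  exact: leq_trans (leq_maxr _ _) (leq_bigmax i).
pose E := (r * d).+1; pose D := (E ^ #|V|)%N; exists D.
pose q (e : {ffun 'I_r -> 'I_D.+1}) := \prod_i (f i ^+ e i * g i ^+ (D - e i)).
pose M := (r * (D * d))%N.
have qM e : (msize (q e) <= M.+1)%N.
  apply: msize_prod_leS => i.
  rewrite -[X in (X * d)%N](subnKC (leq_ord (e i))) mulnDl.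
  by apply: msizeM_leS; apply: msizeX_leS; apply: leqW.
pose B := pffun_on (ord0 : 'I_M.+1) (mem V) predT.
pose mon (b : {ffun 'I_n -> 'I_M.+1}) : 'X_{1..n} :=
  [multinom (b v : nat) | v < n].
pose A := \matrix_(i < #|{ffun 'I_r -> 'I_D.+1}|, j < #|B|)
            (q (enum_val i))@_(mon (enum_val j)).
have cardB : (#|B| < #|{ffun 'I_r -> 'I_D.+1}|)%N.
  rewrite card_pffun_on card_ffun !card_ord.
  (* [(M + 1) ^ #|V| <= (E * (D + 1)) ^ #|V| < (D + 1) ^ (#|V| + 1)], by the
     choice [D = E ^ #|V|]. *)
  have leM : (M.+1 <= E * D.+1)%N.
    rewrite mulSn addSn ltnS /M mulnCA mulnC mulnS addnA.
    exact: leq_addl.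
  apply: leq_ltn_trans (_ : ((E * D.+1) ^ #|V| < _)%N); first by
    have [->|V0] := posnP #|V|; rewrite ?expn0 ?leq_exp2r.
  rewrite expnMn.
  apply: leq_trans (leq_pexp2l _ ltVr) => //.
  by rewrite expnS ltn_pmul2r ?expn_gt0.
have ker0 : kermx A != 0.
  rewrite -mxrank_eq0 mxrank_ker -lt0n subn_gt0.
  exact: leq_ltn_trans (rank_leq_col A) cardB.
pose w := nz_row (kermx A).
have wA : w *m A = 0 by apply/sub_kermxP; apply: nz_row_sub.
exists (fun e => w 0 (enum_rank e)); split.
  have : w != 0 by rewrite nz_row_eq0.
  apply: contraNP => no_e; apply/eqP/rowP => j; rewrite !mxE.
  apply: contrapT => /eqP wj; apply: no_e; exists (enum_val j).
  by rewrite enum_valK.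
move=> m mV; have [mM|mM] := leqP (mdeg m) M; last first.
  rewrite raddf_sum big1 // => e _; rewrite /= mcoeffZ memN_msupp_eq0 ?mulr0 //.
  exact/msize_mdeg_ge/(leq_trans (qM e)).
have mvM v : (m v < M.+1)%N.
  by rewrite ltnS (leq_trans _ mM) // mdegE (bigD1 v) //= leq_addr.
pose b : {ffun 'I_n -> 'I_M.+1} := [ffun v => Ordinal (mvM v)].
have bB : b \in B.
  apply/pffun_onP; split=> //; apply/supportP => v vV.
  by apply/val_inj; rewrite ffunE /= mV.
have -> : m = mon b by apply/mnmP => v; rewrite mnmE ffunE.
have := congr1 (fun u : 'rV_#|B| => u 0 (enum_rank_in bB b)) wA.
rewrite !mxE => <-.
rewrite raddf_sum (reindex _ (onW_bij _ (@enum_val_bij _))) /=.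
by apply: eq_bigr => i _; rewrite mcoeffZ enum_valK !mxE enum_rankK_in.
Qed.

End Counting.

(** * Primes of quotients and localizations *)

Section PrimeIdeals.

Definition kernel (A : comNzRingType) (B : idomainType)
  (h : {rmorphism A -> B}) : {pred A} := fun a => h a == 0.

Lemma kernel_closed (A : comNzRingType) (B : idomainType)
  (h : {rmorphism A -> B}) : idealr_closed (kernel h).
Proof.
split; rewrite ?unfold_in ?rmorph0 ?rmorph1 ?oner_eq0 // => t a b.
by rewrite !unfold_in rmorphD rmorphM => /eqP-> /eqP->; rewrite mulr0 addr0.
Qed.

Lemma kernel_prime (A : comNzRingType) (B : idomainType)
  (h : {rmorphism A -> B}) : prime_idealr_closed (kernel h).
Proof. by move=> a b; rewrite !unfold_in rmorphM mulf_eq0. Qed.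

HB.instance Definition _ (A : comNzRingType) (B : idomainType)
  (h : {rmorphism A -> B}) := isIdealr.Build A (kernel h) (kernel_closed h).
HB.instance Definition _ (A : comNzRingType) (B : idomainType)
  (h : {rmorphism A -> B}) :=
  isPrimeIdealrClosed.Build A (kernel h) (@kernel_prime A B h).

(** The primes of [A / I] are the primes of [A] containing [I]. *)
Lemma quotient_prime (A : comNzRingType) (I : idealr A) (Q : prime_idealr A) :
    {subset I <= Q} ->
  exists Q' : prime_idealr {ideal_quot I},
    forall a, (\pi_{ideal_quot I} a \in Q') = (a \in Q).
Proof.
move=> sIQ; pose Q' : {pred {ideal_quot I}} := fun x => repr x \in Q.
have piQ' a : (\pi_{ideal_quot I} a \in Q') = (a \in Q).
  rewrite -[_ \in Q']/(repr _ \in Q).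
  rewrite -[in RHS](subrK (repr (\pi_{ideal_quot I} a)) a).
  by rewrite rpredDl // sIQ // Quotient.idealrBE reprK.
have clQ' : idealr_closed Q'.
  split.
  - by rewrite -(rmorph0 \pi_{ideal_quot I}) piQ' idealr0.
  - by rewrite -(rmorph1 \pi_{ideal_quot I}) piQ' idealr1.
  - elim/quotW=> t; elim/quotW=> a; elim/quotW=> b.
    by rewrite -rmorphM -rmorphD !piQ' => aQ bQ; rewrite rpredD ?idealMr.
have prQ' : prime_idealr_closed Q'.
  elim/quotW=> a; elim/quotW=> b.
  by rewrite -rmorphM !piQ' prime_idealrM.
pose primeQ' : prime_idealr _ :=
  HB.pack Q' (isIdealr.Build _ Q' clQ') (isPrimeIdealrClosed.Build _ Q' prQ').
by exists primeQ'.
Qed.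

End PrimeIdeals.

Section LocalizationMap.
Variables (A : comNzRingType) (P : prime_idealr A).
Local Notation S := (localization P).
Implicit Types (a b s t : A) (x y : S).

Definition to_loc a : S := \pi_S (a, Localization.denom1 P).

Lemma pi_loc1 : to_loc 1 = 1.
Proof.
by rewrite -[RHS]/(Localization.one P); unlock Localization.one.
Qed.

Lemma to_loc_zmod_morphism : zmod_morphism to_loc.
Proof.
move=> a b; rewrite -[RHS]/(Localization.add _ (Localization.opp _)) /to_loc.
rewrite -Localization.pi_opp -Localization.pi_add.
by apply: Localization.eq_frac => /=; ring.
Qed.

Lemma to_loc_monoid_morphism : monoid_morphism to_loc.
Proof.
split=> [|a b]; first by rewrite pi_loc1.
rewrite -[RHS]/(Localization.mul _ _) /to_loc -Localization.pi_mul.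
by apply: Localization.eq_frac => /=; ring.
Qed.

HB.instance Definition _ :=
  GRing.isZmodMorphism.Build A S to_loc to_loc_zmod_morphism.
HB.instance Definition _ :=
  GRing.isMonoidMorphism.Build A S to_loc to_loc_monoid_morphism.

Lemma to_loc_eq0 a : to_loc a = 0 <-> exists2 s, s \notin P & s * a = 0.
Proof.
rewrite -(rmorph0 to_loc) /to_loc.
split=> [/eqP/Localization.eq_fracP[s]|[s sP sa]].
  by rewrite /= mulr1 mul0r subr0 => sa; exists (val s); first exact: (valP s).
apply/eqP/Localization.eq_fracP; exists (exist _ s sP).
by rewrite /= mulr1 mul0r subr0.
Qed.

Lemma to_loc_unit s : s \notin P -> exists x, x * to_loc s = 1.
Proof.
move=> sP; exists (\pi_S (1, exist _ s sP : Localization.denom P)).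
rewrite -pi_loc1 -[_ * _]/(Localization.mul _ _) -Localization.pi_mul.
by apply: Localization.eq_frac => /=; ring.
Qed.

Lemma fraction x : exists a s, s \notin P /\ x * to_loc s = to_loc a.
Proof.
elim/quotW: x => -[a s]; exists a, (val s); split; first exact: (valP s).
rewrite -[_ * _]/(Localization.mul _ _) -Localization.pi_mul.
by apply: Localization.eq_frac => /=; ring.
Qed.

(** A fraction with numerator outside [P] is invertible, so elements of a proper
    ideal have numerators in [P]; hence [1 - t * x] has numerator outside
    [P]. *)
Lemma proper_ideal_jacobson (I : idealr S) x : x \in I -> in_jacobson_radical x.
Proof.
move=> xI t; have [a [s [sP xa]]] := fraction x.
have [b [s' [s'P tb]]] := fraction t.
have aP : a \in P.
  apply: contraT => /to_loc_unit[v va]; rewrite -(idealr1 I) -va -xa.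
  by rewrite mulrA mulrAC idealMr // mulrC idealMr.
have [v hv] : exists v, v * to_loc (s * s' - b * a) = 1.
  apply: to_loc_unit; rewrite rpredBr ?(idealMr _ aP) //.
  by rewrite prime_idealrM negb_or sP.
exists (v * to_loc (s * s')); rewrite -[RHS]hv rmorphB !rmorphM /= -xa -tb.
by ring.
Qed.

(** The extension of [Q] to the localization; as [Q] is contained in [P], it
    does not depend on the fraction chosen to represent an element. *)
Lemma localization_prime (Q : prime_idealr A) : {subset Q <= P} ->
  exists Q' : prime_idealr S, forall a, (to_loc a \in Q') = (a \in Q).
Proof.
move=> sQP.
pose Q' : {pred S} := fun x =>
  `[< exists a s, [/\ a \in Q, s \notin P & x * to_loc s = to_loc a] >].
have num x a s : s \notin P -> x * to_loc s = to_loc a ->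
    (x \in Q') = (a \in Q).
  move=> sP xs; apply/asboolP/idP => [[b [t [bQ tP xt]]]|aQ]; last first.
    by exists a, s.
  have /to_loc_eq0[r rP] : to_loc (a * t - b * s) = 0.
    by rewrite rmorphB !rmorphM /= -xs -xt; ring.
  have notQ c : c \notin P -> (c \in Q) = false.
    by move=> cP; apply/negP => /sQP cQ; rewrite cQ in cP.
  move=> /(congr1 (fun c => c \in Q)); rewrite idealr0 prime_idealrM notQ //=.
  rewrite rpredBr; last by rewrite mulrC idealMr.
  by rewrite prime_idealrM (notQ t) // orbF.
have locQ' a : (to_loc a \in Q') = (a \in Q).
  by apply: (num _ _ 1); rewrite ?idealr1 // rmorph1 mulr1.
have clQ' : idealr_closed Q'.
  split; rewrite -?(rmorph0 to_loc) -?(rmorph1 to_loc) ?locQ'.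
  - exact: idealr0.
  - by rewrite idealr1.
  move=> z x y.
  have [c [r [rP zc]]] := fraction z.
  have [a [s [sP xa]]] := fraction x; have [b [t [tP yb]]] := fraction y.
  rewrite (num _ _ _ sP xa) (num _ _ _ tP yb) => aQ bQ.
  rewrite (num _ (t * (c * a) + r * s * b) (r * s * t)).
  - by rewrite rpredD // !idealMr.
  - by rewrite !prime_idealrM !negb_or rP sP.
  - by rewrite rmorphD !rmorphM /= -zc -xa -yb; ring.
have prQ' : prime_idealr_closed Q'.
  move=> x y.
  have [a [s [sP xa]]] := fraction x; have [b [t [tP yb]]] := fraction y.
  rewrite (num _ _ _ sP xa) (num _ _ _ tP yb) -prime_idealrM.
  rewrite (num _ (a * b) (s * t)) //; first by rewrite prime_idealrM negb_or sP.
  by rewrite !rmorphM /= -xa -yb; ring.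
pose primeQ' : prime_idealr _ :=
  HB.pack Q' (isIdealr.Build _ Q' clQ') (isPrimeIdealrClosed.Build _ Q' prQ').
by exists primeQ'.
Qed.

Lemma localization_prime_chain N (Q : 'I_N.+1 -> prime_idealr A) :
    (forall i, {subset Q i <= P}) ->
    (forall i j : 'I_N.+1, (i < j)%N ->
       {subset Q i <= Q j} /\ ~ {subset Q j <= Q i}) ->
  prime_chain S N.
Proof.
move=> sQP chainQ.
have /choice[Q' hQ'] := fun i => localization_prime (sQP i).
exists Q' => i j /chainQ[sQij nsQji]; split.
- move=> x; have [a [s [sP xa]]] := fraction x.
  have mem k : (x \in Q' k) = (a \in Q k).
    rewrite -hQ' -xa prime_idealrM hQ' [s \in _]negbTE ?orbF //.
    by apply: contra sP; apply: sQP.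
  by rewrite !mem => /sQij.
- by move=> sQji; apply: nsQji => a; rewrite -!hQ' => /sQji.
Qed.

End LocalizationMap.

(** * Edge ideals at the origin *)

Section EdgeIdeals.
Variables (K : fieldType) (n : nat) (adj : rel 'I_n).
Implicit Types (f g t : {mpoly K[n]}) (F V W : {set 'I_n}).

Definition independent F := {in F &, forall v w, ~~ adj v w}.

Definition maximal_independent F :=
  independent F /\ forall v, v \notin F -> exists2 w, w \in F & adj v w.

Lemma edge_idealX v w : adj v w -> 'X_v * 'X_w \in edge_ideal K adj.
Proof.
move=> vw; apply: mem_gen_ideal; apply/mapP; exists (v, w) => //.
by rewrite mem_filter vw mem_enum.
Qed.

Definition kill_outside V : {rmorphism {mpoly K[n]} -> {mpoly K[n]}} :=
  comp_mpoly [tuple if v \in V then 'X_v else 0 | v < n].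

Lemma kill_outsideX V v :
  kill_outside V 'X_v = if v \in V then 'X_v else 0.
Proof. by rewrite /= comp_mpolyXU -tnth_nth tnth_mktuple. Qed.

Lemma kill_outside_eval0 V f : (kill_outside V f).@[fun=> 0] = f.@[fun=> 0].
Proof.
rewrite comp_mpoly_meval; apply: meval_eq => v; rewrite tnth_mktuple.
by case: ifP; rewrite ?mevalXU ?meval0.
Qed.

Lemma kill_outside_sub V W f : V \subset W ->
  kill_outside V (kill_outside W f) = kill_outside V f.
Proof.
move=> /subsetP sVW; rewrite [kill_outside W f]comp_mpolyE [RHS]comp_mpolyE.
rewrite raddf_sum; apply: eq_bigr => m _.
rewrite /= comp_mpolyZ; congr (_ *: _); rewrite rmorph_prod.
apply: eq_bigr => v _; rewrite rmorphXn !tnth_mktuple /=; congr (_ ^+ _).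
have [vV|vV] := boolP (v \in V); first by rewrite sVW // kill_outsideX vV.
by case: ifP; rewrite ?raddf0 // kill_outsideX (negbTE vV).
Qed.

Lemma kill_outside_edge_ideal V f : independent V ->
  f \in edge_ideal K adj -> kill_outside V f = 0.
Proof.
move=> indV /gen_idealP[c ->]; rewrite raddf_sum big1 // => i _.
have /mapP[[v w]] : (edge_gens K adj)`_i \in edge_gens K adj by apply: mem_nth.
rewrite mem_filter /= => /andP[vw _] ->.
rewrite !rmorphM /= -!/(kill_outside V _) !kill_outsideX.
case: ifP => [vV|_]; last by rewrite mul0r mulr0.
case: ifP => [wV|_]; last by rewrite !mulr0.
by have := indV _ _ vV wV; rewrite vw.
Qed.

(** The product of the variables of a maximal independent set [F] is annihilated
    by every other variable, since that one is adjacent to an element of [F]; so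
    only the monomials in the variables of [F] matter. *)
Lemma edge_ideal_maximal_independent F f : maximal_independent F ->
    (forall m : 'X_{1..n}, (forall v, v \notin F -> m v = 0%N) -> f@_m = 0) ->
  f * \prod_(v in F) 'X_v \in edge_ideal K adj.
Proof.
move=> [_ maxF] f0; rewrite (mpolyE f) mulr_suml big_seq rpred_sum // => m mf.
rewrite -scalerAl -mul_mpolyC; apply: gen_idealMl.
have [v [vF mv]] : exists v, v \notin F /\ m v != 0%N.
  apply: contrapT => no_v; move: mf.
  rewrite -[_ \in _]negbK -mcoeff_eq0 f0 ?eqxx //.
  by move=> v vF; apply/eqP; apply: contraT => mv; case: no_v; exists v.
have [w wF vw] := maxF v vF.
rewrite mpolyXE_id (bigD1 v) //= [\prod_(_ in F) _](bigD1 w) //=.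
rewrite -(prednK (n := m v)) ?lt0n // exprS.
set p := _ ^+ _; set q := \prod_(_ | _) _; set r := \prod_(_ | _) _.
have -> : 'X_v * p * q * ('X_w * r) = p * q * r * ('X_v * 'X_w) by ring.
exact/gen_idealMl/edge_idealX.
Qed.

(** A relation between the numerators [f i] and denominators [g i], as given by
    [algebraic_dependence], turned into one between the fractions [x i]. *)
Lemma clear_denominators (S : comNzRingType) (h : {rmorphism {mpoly K[n]} -> S})
    r (f g : 'I_r -> {mpoly K[n]}) (x : 'I_r -> S) D
    (c : {ffun 'I_r -> 'I_D.+1} -> K) :
    (forall i, x i * h (g i) = h (f i)) ->
  h (\prod_i g i ^+ D) * (\sum_e h (c e)%:MP * \prod_i x i ^+ e i) =
  h (\sum_e c e *: \prod_i (f i ^+ e i * g i ^+ (D - e i))).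
Proof.
move=> xE; rewrite mulr_sumr rmorph_sum; apply: eq_bigr => e _.
rewrite -mul_mpolyC mulrCA rmorphM; congr (_ * _).
rewrite !rmorph_prod -big_split.
apply: eq_bigr => i _; rewrite /= rmorphM !rmorphXn -xE exprMn -mulrA -exprD.
by rewrite subnKC ?leq_ord // mulrC.
Qed.

(** The prime ideal generated by the variables outside [V]. *)
Definition independent_prime V : prime_idealr {mpoly K[n]} :=
  kernel (kill_outside V).

Local Notation A := {ideal_quot edge_ideal K adj}.

Lemma edge_ideal_eval0 :
  {subset edge_ideal K adj <= kernel (meval (fun=> 0 : K))}.
Proof.
move=> f fI; apply/eqP; rewrite /= -(kill_outside_eval0 set0).
by rewrite kill_outside_edge_ideal ?meval0 // => v w; rewrite inE.
Qed.

Section AtOrigin.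
Variable P : prime_idealr A.
Hypothesis PE : forall f, (\pi_A f \in P) = (f.@[fun=> 0] == 0).
Local Notation S := (localization P).

Definition to_local : {rmorphism {mpoly K[n]} -> S} := to_loc P \o \pi_A.

Lemma quotient_surj (x : A) : exists f, x = \pi_A f.
Proof. by exists (repr x); rewrite reprK. Qed.

(** The primes of the chain are generated by the variables outside
    [{v_i, ..., v_(N-1)}], where [V = {v_0, ..., v_(N-1)}]. *)
Lemma independent_le_krull_dim V d : independent V -> krull_dim S d ->
  (#|V| <= d)%N.
Proof.
move=> indV [_ dim]; apply: dim.
pose Vi i := [set v in drop i (enum V)].
have sVi i : Vi i \subset V.
  by apply/subsetP => v; rewrite inE => /mem_drop; rewrite mem_enum.
have sIQ i : {subset edge_ideal K adj <= independent_prime (Vi i)}.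
  move=> f fI; apply/eqP/kill_outside_edge_ideal => // v w.
  by move=> /(subsetP (sVi i)) vV /(subsetP (sVi i)); apply: indV.
have /choice[Q hQ] := fun i : 'I_#|V|.+1 => quotient_prime (sIQ i).
apply: (@localization_prime_chain _ P _ Q) => [i x|i j ij].
  have [f ->] := quotient_surj x; rewrite hQ PE => /eqP f0.
  by rewrite -(kill_outside_eval0 (Vi i)) f0 meval0.
have sVij : Vi j \subset Vi i.
  apply/subsetP => v; rewrite !inE -(subnK (ltnW ij)) -drop_drop.
  exact: mem_drop.
split=> [x|].
  have [f ->] := quotient_surj x; rewrite !hQ => /eqP f0; apply/eqP.
  by rewrite -(kill_outside_sub _ sVij) f0 raddf0.
have ltiV : (i < size (enum V))%N.
  by rewrite -cardE (leq_trans ij) // -ltnS.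
have [v0 _] : {v : 'I_n | true} by case: (enum V) ltiV => // v; exists v.
(* [v_i] lies in the [j]-th prime but not in the [i]-th. *)
pose v := nth v0 (enum V) i.
have vi : v \in Vi i by rewrite inE (drop_nth v0) // mem_head.
have vj : v \notin Vi j.
  apply/negP; rewrite inE => /(nthP v0)[k]; rewrite size_drop nth_drop => kj.
  move/eqP; rewrite nth_uniq ?enum_uniq //; last by rewrite -ltn_subRL.
  by move/eqP => jki; move: ij; rewrite -jki ltnNge leq_addr.
move=> /(_ (\pi_A 'X_v)); rewrite !hQ => sji.
have /sji/eqP : 'X_v \in independent_prime (Vi j).
  by apply/eqP; rewrite kill_outsideX (negbTE vj).
rewrite kill_outsideX vi; apply/eqP.
by rewrite -msize_poly_eq0 msizeX.
Qed.

(** An independent monomial survives killing the variables outside [V], which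
    kills the edge ideal; and a denominator stays nonzero, because its constant
    term does not change. *)
Lemma independent_monomial_neq0 V : independent V ->
  to_local (\prod_(v in V) 'X_v) != 0.
Proof.
move=> indV; apply/negP => /eqP/to_loc_eq0[x]; have [t ->] := quotient_surj x.
rewrite PE => t0 /eqP; rewrite -rmorphM -(rmorph0 \pi_A).
rewrite -Quotient.idealrBE subr0.
move=> /(kill_outside_edge_ideal indV)/eqP; rewrite rmorphM mulf_eq0.
apply/negP; rewrite negb_or; apply/andP; split.
  by apply: contra t0 => /eqP t0; rewrite -(kill_outside_eval0 V) t0 meval0.
rewrite rmorph_prod; apply/prodf_neq0 => v vV.
by rewrite kill_outsideX vV -msize_poly_eq0 msizeX.
Qed.

(** The variables outside [F] generate an associated prime, the annihilator of
    the product of the variables of [F]; its dimension [#|F|] bounds the depth. *)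
Lemma depth_le_maximal_independent F (m : idealr S) d :
  noetherian S -> maximal_independent F -> depth m d -> (d <= #|F|)%N.
Proof.
move=> noeth maxF [[x [xm reg <-]] _]; rewrite leqNgt; apply/negP => ltFx.
have frac (i : 'I_(size x)) : exists fg : {mpoly K[n]} * {mpoly K[n]},
    \pi_A fg.2 \notin P /\ x`_i * to_local fg.2 = to_local fg.1.
  have [a [s [sP xs]]] := fraction x`_i.
  have [f fE] := quotient_surj a; have [g gE] := quotient_surj s.
  by exists (f, g); rewrite /= -fE -gE.
have /choice[fg hfg] := frac.
pose f i := (fg i).1; pose g i := (fg i).2.
have gP i : \pi_A (g i) \notin P by have [] := hfg i.
have xE (i : 'I_(size x)) : x`_i * to_local (g i) = to_local (f i).
  by have [] := hfg i.
have [D [c [[e0 ce0] rel]]] := algebraic_dependence f g ltFx.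
pose T := [set e | c e != 0].
have T0 : T != set0 by apply/set0Pn; exists e0; rewrite inE.
have c_unit : {in T, forall e, exists v, v * to_local (c e)%:MP = 1}.
  move=> e; rewrite inE => ce; exists (to_local (c e)^-1%:MP).
  by rewrite -rmorphM -mpolyCM mulVf // rmorph1.
have := regular_seq_no_relation noeth reg
  (fun y yx => proper_ideal_jacobson (xm _ yx)) T0 c_unit
  (independent_monomial_neq0 maxF.1).
apply/negP; rewrite negbK; apply/eqP.
have [v vg] : exists v, v * to_local (\prod_i g i ^+ D) = 1.
  apply: to_loc_unit; rewrite PE rmorph_prod; apply/prodf_neq0 => i _.
  by rewrite rmorphXn expf_neq0 // -PE.
rewrite -[LHS]mul1r -[X in X * _]vg -mulrA [X in _ * X](_ : _ = 0) ?mulr0 //.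
transitivity (to_local ((\sum_e c e *: \prod_i (f i ^+ e i * g i ^+ (D - e i)))
   * \prod_(v in F) 'X_v)).
  rewrite rmorphM mulrA -(clear_denominators c xE); congr (_ * _ * _).
  rewrite big_mkcond; apply: eq_bigr => e _; rewrite inE.
  by have [->|//] := eqVneq (c e) 0; rewrite mpolyC0 (rmorph0 to_local) mul0r.
rewrite /to_local /= (_ : \pi_A _ = 0) ?rmorph0 //; apply/eqP.
rewrite -(rmorph0 \pi_A) -Quotient.idealrBE subr0.
exact: edge_ideal_maximal_independent rel.
Qed.

End AtOrigin.

(** No variable is invertible at the origin, so the localization there retains
    all the independent sets of the graph. *)
Lemma cohen_macaulay_unmixed F V : cohen_macaulay A ->
  maximal_independent F -> independent V -> (#|V| <= #|F|)%N.
Proof.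
move=> [_ cm] maxF indV.
have [P hP] := quotient_prime edge_ideal_eval0.
have PE f : (\pi_A f \in P) = (f.@[fun=> 0] == 0) by rewrite hP.
have maxP : maximal_ideal P.
  move=> J sPJ x; have [f ->] := quotient_surj x => fJ; rewrite PE.
  apply: contraT => f0; set c := f.@[fun=> 0] in f0.
  have fcJ : \pi_A (f - c%:MP) \in J by rewrite sPJ // PE mevalB mevalC subrr.
  have oneE : 1 = \pi_A (c^-1%:MP * c%:MP) :> A.
    by rewrite -mpolyCM mulVf // mpolyC1 rmorph1.
  rewrite -(idealr1 J) oneE rmorphM idealMr //.
  by rewrite -[c%:MP](subKr f) rmorphB rpredB.
have [noeth [m [_ [d [dep dim]]]]] := cm P maxP.
exact: leq_trans (independent_le_krull_dim PE indV dim)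
  (depth_le_maximal_independent PE noeth maxF dep).
Qed.

End EdgeIdeals.

(** * Levi graphs of line arrangements *)

Section LeviGraph.
Variables (K : fieldType) (k s : nat).
Variables (l : 'I_k -> {vspace 'rV[K]_3}) (p : 'I_s -> {vspace 'rV[K]_3}).
Hypothesis (arr : line_arrangement l) (pts : intersection_points l p).

Local Notation x_ j := (lshift k j).
Local Notation y_ i := (rshift s i).
Local Notation levi := (levi_graph l p).

Lemma levi_xy j i : levi (x_ j) (y_ i) = (p j <= l i)%VS.
Proof. by rewrite /levi_graph (unsplitK (inl j)) (unsplitK (inr i)). Qed.

Lemma levi_yx i j : levi (y_ i) (x_ j) = (p j <= l i)%VS.
Proof. by rewrite /levi_graph (unsplitK (inl j)) (unsplitK (inr i)). Qed.

Lemma levi_xx j j' : levi (x_ j) (x_ j') = false.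
Proof. by rewrite /levi_graph (unsplitK (inl j)) (unsplitK (inl j')). Qed.

Lemma levi_yy i i' : levi (y_ i) (y_ i') = false.
Proof. by rewrite /levi_graph (unsplitK (inr i)) (unsplitK (inr i')). Qed.

Definition levi_edgeE := (levi_xy, levi_yx, levi_xx, levi_yy).

Lemma dim_meet i i' : i != i' -> \dim (l i :&: l i') = 1%N.
Proof.
case: arr => l_inj dim_l ii'; apply/eqP; rewrite eqn_leq; apply/andP; split.
  suff: (\dim (l i :&: l i') < \dim (l i))%N by rewrite dim_l.
  rewrite ltn_neqAle dimvS ?capvSl // andbT.
  apply: contra ii' => eq_dim; apply/eqP/l_inj/eqP.
  rewrite eqEdim !dim_l leqnn andbT; apply/capv_idPl/eqP.
  by rewrite eqEdim capvSl (eqP eq_dim) /=.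
rewrite -(leq_add2l (\dim (l i + l i'))) dimv_sum_cap !dim_l.
rewrite addn1 ltnS; apply: leq_trans (dimvS (subvf _)) _.
by rewrite dimvf dim_matrix.
Qed.

Lemma ex_common_point i i' : i != i' ->
  exists j, (p j <= l i)%VS /\ (p j <= l i')%VS.
Proof.
move=> ii'; have [_ /(_ (l i :&: l i')%VS)[_ []]] := pts.
  by split; [exact: dim_meet | exists i, i'; rewrite capvSl capvSr].
by move=> j pj; exists j; rewrite pj capvSl capvSr.
Qed.

Lemma common_point_uniq i i' j j' : i != i' ->
    (p j <= l i)%VS -> (p j <= l i')%VS ->
    (p j' <= l i)%VS -> (p j' <= l i')%VS -> j = j'.
Proof.
move=> ii' ji ji' j'i j'i'; have [p_inj p_pts] := pts.
have meetE m : (p m <= l i)%VS -> (p m <= l i')%VS -> p m = (l i :&: l i')%VS.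
  move=> mi mi'; apply/eqP; rewrite eqEdim subv_cap mi mi' dim_meet //.
  by have [/(_ (ex_intro _ m erefl))[-> _] _] := p_pts (p m).
by apply: p_inj; rewrite (meetE j) // (meetE j').
Qed.

(** A line with a single point meets every other line there, so the arrangement
    is a pencil and has no other point. *)
Lemma pencil_maximal_independent i0 j0 : (1 < k)%N ->
    (p j0 <= l i0)%VS -> (forall j, (p j <= l i0)%VS -> j = j0) ->
  maximal_independent levi [set x_ j0].
Proof.
move=> k1 j0i0 uniq_j0.
have all_j0 i : (p j0 <= l i)%VS.
  have [<- //|i0i] := eqVneq i0 i.
  by have [j [/uniq_j0-> ?]] := ex_common_point i0i.
split=> [v w|v].
  by rewrite !inE => /eqP-> /eqP->; rewrite levi_edgeE.
case: (split_ordP v) => [j|i] ->; last first.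
  by move=> _; exists (x_ j0); rewrite ?inE // levi_edgeE.
rewrite inE => /negP[]; apply/eqP; congr (lshift _ _).
have [_ /(_ (p j))[/(_ (ex_intro _ j erefl))[_ [i [i' [ii' ji ji']]]] _]] :=
  pts.
exact: common_point_uniq ii' ji ji' (all_j0 i) (all_j0 i').
Qed.

(** A line other than [l i0] has two points, which cannot both be on [l i0]. *)
Lemma line_maximal_independent i0 :
    (forall i, exists j j', [/\ j != j', (p j <= l i)%VS & (p j' <= l i)%VS]) ->
  maximal_independent levi
    (y_ i0 |: [set x_ j | j in [set j | ~~ (p j <= l i0)%VS]]).
Proof.
move=> two_pts; set F := _ |: _.
have yF i : (y_ i \in F) = (i == i0).
  rewrite in_setU1 (inj_eq (@rshift_inj _ _)) orb_idr // => /imsetP[j _ /eqP].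
  by rewrite eq_rlshift.
have xF j : (x_ j \in F) = ~~ (p j <= l i0)%VS.
  by rewrite in_setU1 eq_lrshift /= mem_imset ?inE //; exact: lshift_inj.
split=> [v w|v].
  case: (split_ordP v) => a ->; case: (split_ordP w) => b ->;
    rewrite ?xF ?yF levi_edgeE //.
  - by move=> aF /eqP->.
  - by move=> /eqP->.
case: (split_ordP v) => [j|i] ->.
  by rewrite xF negbK => ji0; exists (y_ i0); rewrite ?yF ?levi_edgeE.
rewrite yF => ii0; have [j [j' [jj' ji j'i]]] := two_pts i.
have [ji0|ji0] := boolP (p j <= l i0)%VS; last first.
  by exists (x_ j); rewrite ?xF ?levi_edgeE.
exists (x_ j'); rewrite ?levi_edgeE // xF; apply: contra jj' => j'i0.
by apply/eqP; apply: common_point_uniq ii0 ji ji0 j'i j'i0.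
Qed.

Lemma independent_points : independent levi [set x_ j | j in 'I_s].
Proof. by move=> _ _ /imsetP[j _ ->] /imsetP[j' _ ->]; rewrite levi_edgeE. Qed.

Lemma independent_lines : independent levi [set y_ i | i in 'I_k].
Proof. by move=> _ _ /imsetP[i _ ->] /imsetP[i' _ ->]; rewrite levi_edgeE. Qed.

End LeviGraph.

Theorem theorem5p5 (K : fieldType) (k s : nat)
    (l : 'I_k -> {vspace 'rV[K]_3}) (p : 'I_s -> {vspace 'rV[K]_3}) :
  (3 <= k)%N ->
  line_arrangement l ->
  intersection_points l p ->
  ~ cohen_macaulay {ideal_quot (edge_ideal K (levi_graph l p))}.
Proof.
move=> k3 arr pts CM.
have i0 : 'I_k by apply: (Ordinal (n := k) (m := 0)); apply: leq_trans k3.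
have [two_pts|] := pselect (forall i, exists j j',
  [/\ j != j', (p j <= l i)%VS & (p j' <= l i)%VS]).
  have := cohen_macaulay_unmixed CM
    (line_maximal_independent arr pts i0 two_pts) (independent_points l p).
  rewrite card_imset; last exact: lshift_inj.
  have [j [j' [jj' ji j'i]]] := two_pts i0.
  rewrite cardsU1 card_imset; last exact: lshift_inj.
  rewrite -(cardsC [set j | (p j <= l i0)%VS]).
  have -> : ~: [set j | (p j <= l i0)%VS] = [set j | ~~ (p j <= l i0)%VS].
    by apply/setP => m; rewrite !inE.
  rewrite leq_add2r leqNgt; case/negP.
  apply: leq_ltn_trans (leq_b1 _) _.
  apply: leq_trans (subset_leq_card (_ : [set j; j'] \subset _)).
    by rewrite cards2 jj'.
  by apply/subsetP => m; rewrite !inE => /orP[] /eqP->.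
move/existsNP => [i one_pt].
have uniq_pt j j' : (p j <= l i)%VS -> (p j' <= l i)%VS -> j = j'.
  by move=> ji j'i; apply: contrapT => /eqP jj'; apply: one_pt; exists j, j'.
have [i' ii'] : exists i', i != i'.
  have /card_gt1P[a [b [_ _ ab]]] : (1 < #|'I_k|)%N.
    by rewrite card_ord (ltnW k3).
  by have [ia|] := eqVneq i a; [exists b; rewrite ia | exists a].
have [j [ji _]] := ex_common_point arr pts ii'.
have max_j := pencil_maximal_independent arr pts (ltnW k3) ji
  (fun j' j'i => uniq_pt _ _ j'i ji).
have := cohen_macaulay_unmixed CM max_j (independent_lines l p).
rewrite cards1 card_imset ?card_ord; last exact: rshift_inj.
by rewrite leqNgt (ltnW k3).
Qed.
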